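(* For all $k\geq 2$, $$\sum_{n\geq0}I^e_{2134\cdots k;1}(n)\,x^n=(1-x^2)\sum_{j=3}^{k}\frac{x^{k+2-j}R^e_{j-1}(x^2)\prod_{i=j}^{k}R_i(-x^2)}{U_j\left(\frac{1}{2x}\right)}.$$
   Context: $2134\cdots k$ denotes the permutation $(2,1,3,4,\dots,k)$ (for $k=2$ it is $21$). For a pattern $\tau$ and $r\geq0$, $I^e_{\tau;r}(n)$ is the number of even involutions $\pi\in\mathfrak{S}_n$ (i.e. $\pi=\pi^{-1}$ with an even number of inversions, an inversion being a pair $i<j$ with $\pi_i>\pi_j$) that avoid $132$ and contain $\tau$ exactly $r$ times (an occurrence of $\tau\in\mathfrak{S}_m$ is an index set $i_1<\dots<i_m$ with $\pi_{i_1}\cdots\pi_{i_m}$ order-isomorphic to $\tau$). $U_r$ is the Chebyshev polynomial of the second kind ($U_0=1$, $U_1(t)=2t$, $U_r(t)=2tU_{r-1}(t)-U_{r-2}(t)$). For $k\geq1$, $R_k(x)=\dfrac{U_{k-1}\left(\frac{1}{2\sqrt{x}}\right)}{\sqrt{x}\,U_k\left(\frac{1}{2\sqrt{x}}\right)}$ (rational in $x$; $R_1=1$, $R_k=1/(1-xR_{k-1})$), and $R^e_k(x)=\tfrac12(R_k(x)+R_k(-x))$. An empty sum is $0$. *)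

(* Defs.v *)
From HB Require Import structures.
From mathcomp Require Import all_boot all_order all_fingroup all_algebra all_field.
From mathcomp Require Import boolp classical_sets.

Set Implicit Arguments.
Unset Strict Implicit.
Unset Printing Implicit Defensive.

Import GRing.Theory.

Local Open Scope ring_scope.

Notation "p %:F" := (@FracField.tofrac _ p) : ring_scope.

Section Permutations.

Variable n : nat.
Implicit Types (s : 'S_n) (tau : seq nat).

(* [occ tau s] counts the occurrences in [s] of the pattern with one-line
   notation [tau] : an index set i_1 < ... < i_m is encoded by its increasing
   enumeration. Only the relative order of the letters of [tau] matters, so
   patterns are written with letters 1, ..., m although 'I_n starts at 0. *)
Definition is_occ tau s (f : {ffun 'I_(size tau) -> 'I_n}) : bool :=
  [forall a : 'I_(size tau), forall b : 'I_(size tau),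
     (a < b)%N ==> (f a < f b)%N] &&
  [forall a : 'I_(size tau), forall b : 'I_(size tau),
     (nth 0%N tau a < nth 0%N tau b)%N == (s (f a) < s (f b))%N].

Definition occ tau s : nat :=
  #|[set f : {ffun 'I_(size tau) -> 'I_n} | is_occ s f]|.

Definition inversions s : nat :=
  #|[set p : 'I_n * 'I_n | (p.1 < p.2)%N && (s p.2 < s p.1)%N]|.

Definition even_inversions s : bool := ~~ odd (inversions s).

Definition involution s : bool := s == (s^-1)%g.

Definition avoids tau s : bool := occ tau s == 0%N.

End Permutations.

Definition even_inv_count (tau : seq nat) (r n : nat) : nat :=
  #|[set s : 'S_n | [&& involution s, even_inversions s,
                        avoids [:: 1; 3; 2]%N s & occ tau s == r]]|.

Definition pattern2134 (k : nat) : seq nat := [:: 2, 1 & iota 3 (k - 2)]%N.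

(* [f], a rational function of 'X, is the generating function of [a]: it is a
   quotient p / q with q(0) != 0, and p = q * sum_n a_n 'X^n as formal power
   series. *)
Definition is_gen_fun (C : fieldType) (a : nat -> C)
    (f : {fraction {poly C}}) : Prop :=
  exists p q : {poly C},
    [/\ q`_0 != 0, f = p%:F / q%:F
      & forall n, \sum_(i < n.+1) q`_i * a (n - i)%N = p`_n].

Fixpoint chebU (A : nzRingType) (r : nat) (t : A) : A :=
  match r with
  | 0 => 1
  | r1.+1 => match r1 with
             | 0 => 2%:R * t
             | r2.+1 => 2%:R * t * chebU r1 t - chebU r2 t
             end
  end.

Section ChebyshevQuotients.

Variable F : fieldType.
Implicit Types (x s : F) (k : nat).

(* Some square root of [x], and 0 if there is none; [chebR] below does not depend
   on the choice of the root (lemma [chebR_sqr]). *)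
Definition sqrt_of x : F := xget 0 [set s | s ^+ 2 = x]%classic.

Definition chebR k x : F :=
  chebU k.-1 (1 / (2%:R * sqrt_of x))
    / (sqrt_of x * chebU k (1 / (2%:R * sqrt_of x))).

Definition chebRe k x : F := 1 / 2%:R * (chebR k x + chebR k (- x)).

Lemma sqrt_of_sqr s : sqrt_of (s ^+ 2) = s \/ sqrt_of (s ^+ 2) = - s.
Proof.
have /eqP : sqrt_of (s ^+ 2) ^+ 2 = s ^+ 2.
  exact: (@xgetPex _ 0 [set t | t ^+ 2 = s ^+ 2]%classic (ex_intro _ s erefl)).
by rewrite eqf_sqr => /orP[] /eqP ->; [left | right].
Qed.

Lemma chebU_opp k (t : F) : chebU k (- t) = (-1) ^+ k * chebU k t.
Proof.
suff : chebU k (- t) = (-1) ^+ k * chebU k t /\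
       chebU k.+1 (- t) = (-1) ^+ k.+1 * chebU k.+1 t by case.
elim: k => [|k [IH1 IH2]].
  by split; rewrite /= ?expr0 ?mul1r // expr1 mulN1r mulrN.
split=> //.
have E u : chebU k.+2 u = 2%:R * u * chebU k.+1 u - chebU k u by [].
rewrite !E IH1 IH2 !exprS !mulN1r opprK mulrBr; congr (_ - _).
by rewrite !mulNr !mulrN !mulNr opprK mulrCA.
Qed.

Lemma chebR_sqr k s : (0 < k)%N ->
  chebR k (s ^+ 2) =
    chebU k.-1 (1 / (2%:R * s)) / (s * chebU k (1 / (2%:R * s))).
Proof.
case: k => // k _; rewrite /chebR; case: (sqrt_of_sqr s) => -> //.
rewrite mulrN invrN mulrN !chebU_opp -!pred_Sn exprS mulN1r !mulNr !mulrN opprK.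
by rewrite mulrCA -mulf_div divff ?mul1r // signr_eq0.
Qed.

End ChebyshevQuotients.

(* Main.v *)
(** A nonempty 132-avoiding permutation is uniquely (L (+) 1) (-) R with L, R
    avoiding 132, so such permutations are encoded by binary trees. The pattern
    213...k is skew-indecomposable and is the shorter pattern followed by its
    maximum, whence
      occ_k((L (+) 1) (-) R) = occ_k(L) + occ_(k-1)(L) + occ_k(R)   (k >= 3),
    and inversion is mirroring of trees. An involution is thus empty, L (+) 1
    with L an involution, or A (-) M (-) A^-1 with A = L (+) 1 arbitrary and M
    an involution. In the last case one occurrence of 213...k must lie in M,
    while L avoids 213...(k-1) and contributes the sign (-1)^(|L|+1). For
    e = 1, -1 this gives, for the generating functions F_k weighted by
    e^inversions,
      F_3 = e x^3 + e x^2 R_2(e x^2) F_3,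
      F_k = x F_(k-1) + e x^2 R_(k-1)(e x^2) F_k   (k >= 4),
    hence F_k(x) = e x^k R_3(e x^2) ... R_k(e x^2). The even part, one half of
    the sum over e, telescopes into the stated sum. *)
Require Import Defs.
From HB Require Import structures.
From mathcomp Require Import all_boot all_order all_fingroup all_algebra all_field.
From mathcomp Require Import zify ring.

Set Implicit Arguments.
Unset Strict Implicit.
Unset Printing Implicit Defensive.

Import GRing.Theory.

(** * Pattern occurrences in words *)

(** Subsequences are listed by position, with repetitions, so [count] over this list counts index
    sets. *)
Fixpoint subs (T : Type) (m : nat) (w : seq T) {struct w} : seq (seq T) :=
  match m, w with
  | 0, _ => [:: [::]]
  | _.+1, [::] => [::]
  | m'.+1, x :: w' => [seq x :: t | t <- subs m' w'] ++ subs m w'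
  end.

Lemma subs0 (T : Type) (w : seq T) : subs 0 w = [:: [::]].
Proof. by case: w. Qed.

Lemma subsS (T : Type) m x (w : seq T) :
  subs m.+1 (x :: w) = [seq x :: t | t <- subs m w] ++ subs m.+1 w.
Proof. by []. Qed.

Lemma mem_subs (T : eqType) m (w t : seq T) :
  (t \in subs m w) = subseq t w && (size t == m).
Proof.
elim: w m t => [|x w IH] [|m] t.
- by rewrite inE subseq0 andbC; case: t.
- by rewrite in_nil subseq0; case: t.
- by rewrite subs0 inE; case: t => // y t; rewrite /= andbF.
rewrite subsS mem_cat (IH m.+1); case: t => [|y t].
  by rewrite sub0seq /= orbF; apply/mapP => -[].
rewrite /=; case: (y =P x) => [->|neq].
  rewrite mem_map; last by move=> ? ? [].
  rewrite IH eqSS; case: (size t == m) => /=; last by rewrite !andbF.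
  rewrite !andbT; apply/orP/idP => [[//|]|->]; last by left.
  by move=> h; exact: (subseq_trans (subseq_cons t x) h).
suff -> : (y :: t \in [seq x :: t0 | t0 <- subs m w]) = false by [].
by apply/mapP => -[u _ [/neq]].
Qed.

Lemma subs_uniq (T : eqType) m (w : seq T) : uniq w -> uniq (subs m w).
Proof.
elim: w m => [|x w IH] [|m] //= /andP[xw uw].
rewrite cat_uniq IH // andbT map_inj_uniq ?IH //; last by move=> ? ? [].
apply/hasPn => t; rewrite mem_subs => /andP[tw _].
apply/mapP => -[u _ Eu]; case/negP: xw; apply: (mem_subseq tw).
by rewrite Eu mem_head.
Qed.

Lemma subs_map (T S : Type) (f : T -> S) m (w : seq T) :
  subs m (map f w) = map (map f) (subs m w).
Proof.
elim: w m => [|x w IH] [|m] //=.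
by rewrite map_cat IH -!map_comp (IH m.+1).
Qed.

Lemma subs_filter (T : Type) (p : pred T) m (w : seq T) :
  filter (all p) (subs m w) = subs m (filter p w).
Proof.
elim: w m => [|x w IH] [|m]; rewrite ?subs0 //.
rewrite subsS filter_cat IH filter_map /=.
rewrite (@eq_filter _ _ (fun t => p x && all p t)) //.
by case: (p x); rewrite /= ?IH ?filter_pred0.
Qed.

(** Patterns and words grow by a final maximum while [subs] recurses at the front; this gives the
    recursion at the other end. *)
Lemma count_subs_rcons (T : Type) (P : pred (seq T)) m x (w : seq T) :
  count P (subs m.+1 (rcons w x)) =
  (count P (subs m.+1 w) + count (fun t => P (rcons t x)) (subs m w))%N.
Proof.
elim: w m P => [|y w IH] m P.
  by case: m => [|m] //=; rewrite addn0.
rewrite rcons_cons !subsS count_cat count_map IH count_cat count_map.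
case: m => [|m]; first by rewrite !subs0 /= addnA.
rewrite IH subsS count_cat count_map !addnA; congr (_ + _)%N.
by rewrite -!addnA; congr (_ + _)%N; rewrite addnC.
Qed.

Definition oiso (tau t : seq nat) : bool :=
  (size t == size tau) &&
  all (fun a => all (fun b =>
    (nth 0 tau a < nth 0 tau b)%N == (nth 0 t a < nth 0 t b)%N)
      (iota 0 (size tau))) (iota 0 (size tau)).

Lemma oisoP tau t :
  reflect (size t = size tau /\ forall a b, (a < size tau)%N -> (b < size tau)%N ->
      (nth 0 tau a < nth 0 tau b)%N = (nth 0 t a < nth 0 t b)%N) (oiso tau t).
Proof.
apply: (iffP andP) => [[/eqP-> /allP A]|[-> A]]; split=> //.
  move=> a b ha hb; have /allP/(_ b) := A a ltac:(by rewrite mem_iota).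
  by rewrite mem_iota => /(_ hb)/eqP.
apply/allP => a; rewrite mem_iota => ha; apply/allP => b.
by rewrite mem_iota => hb; rewrite A.
Qed.

Definition wocc (tau w : seq nat) : nat := count (oiso tau) (subs (size tau) w).

Lemma oiso_map tau (f : nat -> nat) t :
  {mono f : x y / (x < y)%N} -> oiso tau (map f t) = oiso tau t.
Proof.
move=> fm; apply/oisoP/oisoP; rewrite size_map => -[st A]; split=> // a b ha hb.
  by rewrite A // !(nth_map 0) ?fm ?st.
by rewrite A // !(nth_map 0) ?fm ?st.
Qed.

Lemma wocc_map tau (f : nat -> nat) w :
  {mono f : x y / (x < y)%N} -> wocc tau (map f w) = wocc tau w.
Proof.
by move=> fm; rewrite /wocc subs_map count_map; apply: eq_count => t /=; rewrite oiso_map.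
Qed.

Lemma subseq_catP (T : eqType) (t u v : seq T) :
  subseq t (u ++ v) -> exists t1 t2, [/\ t = t1 ++ t2, subseq t1 u & subseq t2 v].
Proof.
move=> /subseqP[m sm ->]; rewrite size_cat in sm.
exists (mask (take (size u) m) u), (mask (drop (size u) m) v).
rewrite !mask_subseq -mask_cat ?cat_take_drop //.
by rewrite size_takel // sm leq_addr.
Qed.

(* An occurrence whose first letter is smaller than its last one cannot use
   letters from both sides of a skew sum. *)
Lemma wocc_skew_cat tau (u v : seq nat) :
  (1 < size tau)%N -> (nth 0 tau 0 < nth 0 tau (size tau).-1)%N ->
  (forall x y, x \in u -> y \in v -> (y < x)%N) ->
  wocc tau (u ++ v) = (wocc tau u + wocc tau v)%N.
Proof.
move=> st hl uv.
pose p := mem u; pose w := u ++ v.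
have fu : filter p w = u.
  rewrite filter_cat (_ : filter _ v = [::]) ?cats0 //.
    by apply/all_filterP/allP.
  apply/eqP; rewrite -(negbK (_ == _)) -has_filter; apply/hasPn => y yv.
  by apply/negP => yu; have := uv _ _ yu yv; rewrite ltnn.
have fv : filter (predC p) w = v.
  rewrite filter_cat (_ : filter _ u = [::]); last first.
    by apply/eqP; rewrite -(negbK (_ == _)) -has_filter; apply/hasPn => y yu; rewrite /= negbK.
  apply/all_filterP/allP => y yv; apply/negP => yu.
  by have := uv _ _ yu yv; rewrite ltnn.
rewrite -/w /wocc -[X in _ = (count _ (subs _ X) + _)%N]fu -[X in _ = (_ + count _ (subs _ X))%N]fv.
rewrite -!subs_filter !count_filter -[RHS]count_predUI.
(* Inclusion-exclusion over the subsequences of [w] lying in one block: an occurrence has a first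
   letter, which cannot belong to both blocks, so the overlap is empty. *)
rewrite [X in (_ + X)%N](_ : _ = 0%N); last first.
  apply/eqP; rewrite -leqn0 leqNgt -has_count; apply/hasPn => t _ /=.
  apply/negP => /andP[/andP[/oisoP[sz _] /allP A] /andP[_ /allP B]].
  have t0 : nth 0 t 0 \in t by rewrite mem_nth // sz ltnW.
  by have /negP[] := B _ t0; apply: A.
rewrite addn0; apply: eq_in_count => t; rewrite mem_subs => /andP[tw _] /=.
case: (boolP (oiso tau t)) => //= /oisoP[sz A]; apply/esym.
have [t1 [t2 [Et t1u t2v]]] := subseq_catP tw.
have {t2v}t2v : {subset t2 <= predC p}.
  by move=> y /(mem_subseq t2v) yv; apply/negP => /uv/(_ yv); rewrite ltnn.
have {}t1u := mem_subseq t1u.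
case: t2 Et t2v => [|y2 t2] Et t2v.
  by apply/orP; left; apply/allP => x; rewrite Et cats0; apply: t1u.
case: t1 Et t1u => [|y1 t1] Et t1u.
  by apply/orP; right; apply/allP => x; rewrite Et; apply: t2v.
have := A 0 (size tau).-1; rewrite hl -sz.
have -> : nth 0 t (size t).-1 = last y2 t2.
  by rewrite nth_last Et last_cat.
rewrite Et /= size_cat /= => /(_ isT (leqnn _))/esym.
have /uv h : y1 \in u by rewrite t1u ?mem_head.
have : last y2 t2 \in v.
  have : last y2 t2 \in w by apply: (mem_subseq tw); rewrite Et mem_cat mem_last orbT.
  by rewrite mem_cat => /orP[|//] /(negP (t2v _ (mem_last _ _))).
by move=> /h; rewrite ltnNge => /negP h1 /ltnW.
Qed.

Lemma mem_iota0 n a : (a \in iota 0 n) = (a < n)%N.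
Proof. by rewrite mem_iota. Qed.

Lemma oiso_rcons tau M t x :
  {in tau, forall y, y < M}%N -> {in t, forall y, y < x}%N ->
  oiso (rcons tau M) (rcons t x) = oiso tau t.
Proof.
move=> tM tx; rewrite /oiso !size_rcons eqSS; case: eqP => // st; rewrite !andTb.
have nthM a : (a < size tau)%N -> (nth 0 tau a < M)%N.
  by move=> ha; apply: tM; rewrite mem_nth.
have nthx a : (a < size tau)%N -> (nth 0 t a < x)%N.
  by move=> ha; apply: tx; rewrite mem_nth ?st.
have nE (s : seq nat) y a : nth 0 (rcons s y) a =
    if (a < size s)%N then nth 0 s a else if a == size s then y else 0.
  exact: nth_rcons.
apply/idP/idP => /allP A; apply/allP => a; rewrite mem_iota0 => ha; apply/allP => b;
  rewrite mem_iota0 => hb.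
  have /allP/(_ b) := A a ltac:(by rewrite mem_iota0 ltnW).
  by rewrite mem_iota0 ltnW // !nE st ha hb; apply.
rewrite !nE st; move: ha hb; rewrite !ltnS (leq_eqVlt a) (leq_eqVlt b).
case: (a =P size tau) => [->|_] /=; rewrite ?ltnn ?eqxx => ha;
  case: (b =P size tau) => [->|_] /=; rewrite ?ltnn ?eqxx //= => hb.
- by rewrite hb !ltnNge !(ltnW (nthM _ hb)) !(ltnW (nthx _ hb)).
- by rewrite ha nthM // nthx.
have /allP/(_ b) := A a ltac:(by rewrite mem_iota0).
by rewrite ha hb mem_iota0; apply.
Qed.

(** An occurrence using [x] ends with it, so [x] plays the role of [M] and the other letters form an
    occurrence of [tau]. *)
Lemma wocc_rcons_max tau M u x :
  {in tau, forall y, y < M}%N -> {in u, forall y, y < x}%N ->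
  wocc (rcons tau M) (rcons u x) = (wocc (rcons tau M) u + wocc tau u)%N.
Proof.
move=> tM ux; rewrite /wocc !size_rcons count_subs_rcons; congr (_ + _)%N.
apply: eq_in_count => t; rewrite mem_subs => /andP[tu _].
by rewrite oiso_rcons // => y /(mem_subseq tu); apply: ux.
Qed.

Definition p132 : seq nat := [:: 1; 3; 2].

Lemma oiso132 a b c : oiso p132 [:: a; b; c] = (a < c < b)%N.
Proof.
apply/oisoP/idP => [[_ A]|h].
  by have := (A 0 2 isT isT, A 2 1 isT isT) => /= -[]; lia.
by split=> // -[|[|[|//]]] [|[|[|//]]] //= _ _; lia.
Qed.

(** The last letter of 132 is not its largest, so a final maximum belongs to no occurrence. *)
Lemma wocc132_rcons_max u x : {in u, forall y, y < x}%N ->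
  wocc p132 (rcons u x) = wocc p132 u.
Proof.
move=> ux; rewrite /wocc count_subs_rcons -[RHS]addn0; congr (_ + _)%N.
apply/eqP; rewrite -leqn0 leqNgt -has_count; apply/hasPn => t.
rewrite mem_subs => /andP[tu]; case: t tu => [|a [|b []]] //= tu _.
rewrite oiso132; have := ux b ltac:(by apply: (mem_subseq tu); rewrite !inE eqxx orbT).
lia.
Qed.

Lemma wocc132_gt0 u v l r m : l \in u -> r \in v -> (l < r < m)%N ->
  (0 < wocc p132 (u ++ m :: v))%N.
Proof.
move=> lu rv h; rewrite -has_count; apply/hasP; exists [:: l; m; r]; last by rewrite oiso132.
rewrite mem_subs andbT -cat1s; apply: cat_subseq; first by rewrite sub1seq.
by rewrite /= eqxx sub1seq.
Qed.

(** * Inversions of words *)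

Fixpoint invw (w : seq nat) : nat :=
  if w is x :: w' then (count (fun y => y < x) w' + invw w')%N else 0.

Lemma oiso21 a b : oiso [:: 2; 1] [:: a; b] = (b < a)%N.
Proof.
apply/oisoP/idP => [[_ /(_ 1 0 isT isT)]//|ba].
split=> // -[|[|//]] [|[|//]] //= _ _; lia.
Qed.

Lemma wocc21 w : wocc [:: 2; 1] w = invw w.
Proof.
rewrite /wocc /=; elim: w => //= x w <-; rewrite count_cat; congr (_ + _)%N.
rewrite count_map.
have -> : subs 1 w = [seq [:: y] | y <- w] by elim: w => //= y w ->; rewrite subs0.
by rewrite count_map; apply: eq_count => y /=; rewrite oiso21.
Qed.

Lemma invw_skew_cat (u v : seq nat) : (forall x y, x \in u -> y \in v -> (y < x)%N) ->
  invw (u ++ v) = (invw u + invw v + size u * size v)%N.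
Proof.
elim: u => [|x u IH] uv /=; first by rewrite addn0.
rewrite IH; last by move=> a b au; apply: uv; rewrite inE au orbT.
rewrite count_cat; suff -> : count (fun y => (y < x)%N) v = size v by rewrite mulSn -!addnA; congr (_ + _)%N; rewrite addnCA; congr (_ + _)%N; rewrite addnCA.
by apply/eqP; rewrite -all_count; apply/allP => y; apply: uv; rewrite mem_head.
Qed.

Lemma invw_rcons_max u x : {in u, forall y, y < x}%N -> invw (rcons u x) = invw u.
Proof.
elim: u => //= y u IH ux; rewrite IH; last by move=> a au; apply: ux; rewrite inE au orbT.
by rewrite -cats1 count_cat /= ltnNge ltnW ?ux ?mem_head //= !addn0.
Qed.

Lemma invw_map (f : nat -> nat) w : {mono f : x y / (x < y)%N} -> invw (map f w) = invw w.
Proof.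
move=> fm; elim: w => //= x w ->; rewrite count_map; congr (_ + _)%N.
by apply: eq_count => y /=; rewrite fm.
Qed.

(** * Binary trees and 132-avoiding permutations *)

Inductive tree := Leaf | Node of tree & tree.

Lemma tree_eq_dec : comparable tree.
Proof. by move=> s t; rewrite /decidable; decide equality. Qed.

HB.instance Definition _ := hasDecEq.Build tree (compareP tree_eq_dec).

(** The operations L (+) 1 and (-) of the overview, on words with letters starting at 0; this is why
    the new maximum is [size u]. *)
Definition dsum1 (u : seq nat) := rcons u (size u).
Definition skew (u v : seq nat) := map (addn (size v)) u ++ v.

Fixpoint word (t : tree) : seq nat :=
  if t is Node l r then skew (dsum1 (word l)) (word r) else [::].

Fixpoint tsize (t : tree) : nat :=
  if t is Node l r then (tsize l + tsize r).+1 else 0.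

(** A tree is read as the list of components L (+) 1 along its right spine. [app] concatenates such
    lists, which is the skew sum of words; [mir] reverses the list and mirrors each component. *)
Fixpoint app (s t : tree) : tree :=
  if s is Node l r then Node l (app r t) else t.

Fixpoint mir (t : tree) : tree :=
  if t is Node l r then app (mir r) (Node (mir l) Leaf) else Leaf.

(* Occurrences of 213...(m+2). The pattern 21 of the case m = 0, unlike the
   others, also occurs across the two sides of a skew sum. *)
Fixpoint tocc (m : nat) (t : tree) : nat :=
  if t is Node l r then
    if m is m'.+1 then (tocc m l + tocc m' l + tocc m r)%N
    else (tocc 0 l + tocc 0 r + (tsize l).+1 * tsize r)%N
  else 0.

Lemma size_dsum1 u : size (dsum1 u) = (size u).+1.
Proof. by rewrite size_rcons. Qed.

Lemma size_skew u v : size (skew u v) = (size u + size v)%N.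
Proof. by rewrite size_cat size_map. Qed.

Lemma size_word t : size (word t) = tsize t.
Proof. by elim: t => //= l IHl r IHr; rewrite size_skew size_dsum1 IHl IHr. Qed.

(** Together with [uniq], this makes [u] the one-line notation of a permutation. *)
Definition below (u : seq nat) := {in u, forall y, y < size u}%N.

Lemma below_dsum1 u : below u -> below (dsum1 u).
Proof.
move=> bu x; rewrite mem_rcons inE size_dsum1 => /orP[/eqP->//|/bu/ltnW]; exact.
Qed.

Lemma below_skew u v : below u -> below v -> below (skew u v).
Proof.
move=> bu bv x; rewrite size_skew mem_cat => /orP[/mapP[y /bu yu ->]|/bv]; lia.
Qed.

Lemma below_word t : below (word t).
Proof. by elim: t => //= l IHl r IHr; apply: below_skew => //; apply: below_dsum1. Qed.

Lemma uniq_word t : uniq (word t).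
Proof.
elim: t => //= l IHl r IHr; rewrite cat_uniq IHr andbT map_inj_uniq; last exact: addnI.
rewrite rcons_uniq IHl andbT; apply/andP; split.
  by apply/negP => /below_word; rewrite ltnn.
by apply/hasPn => y /below_word yr; apply/mapP => -[z _ E]; rewrite E in yr; lia.
Qed.

Lemma skew_gt u v : below v ->
  forall x y, x \in map (addn (size v)) u -> y \in v -> (y < x)%N.
Proof. by move=> bv x y /mapP[z _ ->] /bv; lia. Qed.

Lemma addn_mono a : {mono addn a : x y / (x < y)%N}.
Proof. by move=> x y; rewrite ltn_add2l. Qed.

Lemma wocc_skew tau u v :
  (1 < size tau)%N -> (nth 0 tau 0 < nth 0 tau (size tau).-1)%N -> below v ->
  wocc tau (skew u v) = (wocc tau u + wocc tau v)%N.
Proof.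
move=> st hl bv; rewrite wocc_skew_cat //; last exact: skew_gt.
by rewrite wocc_map //; apply: addn_mono.
Qed.

Lemma pattern2134S m : pattern2134 m.+3 = rcons (pattern2134 m.+2) m.+3.
Proof.
by rewrite /pattern2134 !subSS !subn0 !rcons_cons -[X in iota 3 X]addn1 iotaD cats1.
Qed.

Lemma pattern2134_lt m : {in pattern2134 m.+2, forall y, y < m.+3}%N.
Proof. by move=> y; rewrite !inE !subSS subn0 mem_iota; lia. Qed.

(** From length 3 on, the last letter of the pattern is its maximum and exceeds its first letter, so
    [wocc_skew] and [wocc_rcons_max] apply; for 21, the pairs across a skew sum come from
    [invw_skew_cat]. *)
Lemma wocc_word m t : wocc (pattern2134 m.+2) (word t) = tocc m t.
Proof.
elim: t m => [|l IHl r IHr] [|m] //.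
  rewrite [LHS]wocc21 /= invw_skew_cat; last exact/skew_gt/below_word.
  rewrite invw_map ?invw_rcons_max; try exact: addn_mono; last exact: below_word.
  by rewrite -!wocc21 (IHl 0) (IHr 0) size_map size_dsum1 !size_word.
rewrite /= wocc_skew; last exact: below_word.
- rewrite IHr pattern2134S wocc_rcons_max; last exact: below_word.
    by rewrite -pattern2134S !IHl.
  exact: pattern2134_lt.
- by [].
by rewrite pattern2134S size_rcons /= nth_rcons /= size_iota subSS ltnn eqxx.
Qed.

Lemma wocc132_word t : wocc p132 (word t) = 0.
Proof.
elim: t => //= l IHl r IHr; rewrite wocc_skew //; last exact: below_word.
by rewrite IHr wocc132_rcons_max ?IHl //; apply: below_word.
Qed.

Lemma invw_word t : invw (word t) = tocc 0 t.
Proof. by rewrite -wocc21; apply: (wocc_word 0). Qed.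

Lemma below_full u i : uniq u -> below u -> (i < size u)%N -> i \in u.
Proof.
move=> uu bu iu; have [||_ ->] := @uniq_min_size _ u (iota 0 (size u)) uu.
- by move=> x /bu; rewrite mem_iota0.
- by rewrite size_iota.
by rewrite mem_iota0.
Qed.

Lemma mem_word t i : (i \in word t) = (i < tsize t)%N.
Proof.
rewrite -size_word; apply/idP/idP; first exact: below_word.
by apply: below_full; [apply: uniq_word | apply: below_word].
Qed.

Lemma skewA u v w : skew (skew u v) w = skew u (skew v w).
Proof.
rewrite /skew map_cat -catA size_cat size_map -map_comp; congr (_ ++ _).
by apply: eq_map => x /=; rewrite addnA (addnC (size v)).
Qed.

Lemma word_app s t : word (app s t) = skew (word s) (word t).
Proof. by elim: s => //= l _ r ->; rewrite skewA. Qed.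

Definition winv (w : seq nat) : seq nat := [seq index i w | i <- iota 0 (size w)].

(** The low values sit in the final block [v], so in the inverse they come first, with positions
    shifted by [size u]. *)
Lemma winv_skew u v : uniq u -> below u -> below v -> winv (skew u v) = skew (winv v) (winv u).
Proof.
move=> uu bu bv; rewrite /winv size_skew addnC iotaD map_cat add0n; congr (_ ++ _).
  rewrite -map_comp; apply/eq_in_map => i; rewrite mem_iota0 => iv /=.
  rewrite size_map size_iota index_cat size_map ifN //.
  by apply/mapP => -[x _ E]; rewrite E in iv; lia.
rewrite -[X in iota X]addn0 iotaDl -map_comp; apply/eq_in_map => i.
rewrite mem_iota0 => iu /=; rewrite index_cat mem_map; last exact: addnI.
by rewrite (below_full uu bu iu) index_map //; apply: addnI.
Qed.

Lemma winv_dsum1 u : uniq u -> below u -> winv (dsum1 u) = dsum1 (winv u).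
Proof.
move=> uu bu; rewrite /winv size_dsum1 /dsum1 -addn1 iotaD map_cat cats1 size_map size_iota add0n /=.
congr (rcons _ _); last first.
  rewrite -cats1 index_cat ifN /= ?eqxx ?addn0 //.
  by apply/negP => /bu; rewrite ltnn.
apply/eq_in_map => i; rewrite mem_iota0 => iu.
by rewrite -cats1 index_cat (below_full uu bu iu).
Qed.

Lemma word_mir t : word (mir t) = winv (word t).
Proof.
elim: t => //= l IHl r IHr.
have below_l := @below_word l; have uniq_l := uniq_word l.
rewrite word_app /= IHr IHl winv_skew.
- by rewrite winv_dsum1 // [X in skew _ X]cats0 map_id.
- by rewrite rcons_uniq uniq_l andbT; apply/negP => /below_l; rewrite ltnn.
- exact: below_dsum1.
- exact: below_word.
Qed.

Lemma cat_cons_inj (T : eqType) (m : T) (u1 u2 v1 v2 : seq T) :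
  m \notin u1 -> m \notin u2 -> u1 ++ m :: v1 = u2 ++ m :: v2 -> u1 = u2 /\ v1 = v2.
Proof.
move=> h1 h2 E; have /eqP := E; rewrite eqseq_cat; first by case/andP => /eqP-> /eqP[->].
have := congr1 (index m) E.
by rewrite !index_cat (negPf h1) (negPf h2) /= eqxx !addn0.
Qed.

Lemma word_Node l r : word (Node l r) =
  map (addn (tsize r)) (word l) ++ (tsize l + tsize r)%N :: word r.
Proof.
by rewrite /= /skew /dsum1 map_rcons cat_rcons !size_word addnC.
Qed.

(** The largest letter occurs once, so its position determines the words of both subtrees. *)
Lemma word_inj : injective word.
Proof.
elim=> [|l IHl r IHr] [|l' r'] E //.
- by have := congr1 size E; rewrite !size_word.
- by have := congr1 size E; rewrite !size_word.
have := congr1 size E; rewrite !size_word => -[Es].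
have N a b : (tsize a + tsize b)%N \notin map (addn (tsize b)) (word a).
  by apply/mapP => -[x]; rewrite mem_word; lia.
move: E; rewrite !word_Node -Es => /cat_cons_inj[||E1 /IHr Er] //; first by rewrite Es.
by rewrite -Er in E1 *; rewrite (IHl l') //; apply: inj_map E1; apply: addnI.
Qed.

(** Strong induction on the length: the word is cut at its maximum, and 132-avoidance makes the two
    sides a skew sum. *)
Lemma word_surj v : uniq v -> below v -> wocc p132 v = 0 -> exists t, v = word t.
Proof.
have [n] := ubnP (size v); elim: n v => // n IH [|x0 v0] sz uv bv v132; first by exists Leaf.
move Ev0 : (x0 :: v0) sz uv bv v132 => v sz uv bv v132.
have {x0 v0 Ev0}v_gt0 : (0 < size v)%N by rewrite -Ev0.
have mv : (size v).-1 \in v by apply: below_full => //; rewrite prednK.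
move Em : (size v).-1 mv => m mv.
move: sz uv bv v132 v_gt0 Em; case/splitPr: mv => L R sz uv bv v132 v_gt0 Em.
have sLR : m = (size L + size R)%N by rewrite -Em size_cat /= addnS.
move: (uv); rewrite cat_uniq /= negb_or => /and3P[uL /andP[mL /hasPn LR] /andP[mR uR]].
(* Otherwise [x], the maximum [m] and [y] form an occurrence of 132. *)
have LgtR x y : x \in L -> y \in R -> (y < x)%N.
  move=> xL yR; rewrite ltnNge; apply/negP => xy.
  have ym : (y < m)%N.
    have := bv y ltac:(by rewrite mem_cat inE yR !orbT).
    rewrite size_cat /= addnS ltnS -sLR leq_eqVlt => /orP[/eqP E|//].
    by rewrite -E yR in mR.
  have xy' : (x < y)%N.
    by rewrite ltn_neqAle xy andbT; apply: contraNneq (LR _ yR) => <-.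
  by have := @wocc132_gt0 _ _ _ _ m xL yR; rewrite v132 xy' ym => /(_ isT).
(* All values up to a letter [y] of [R] occur in the word, and none of them can lie in [L] or be
   [m]; hence [R] has more than [y] letters. *)
have bR : below R.
  move=> y yR; have : (size (iota 0 y.+1) <= size R)%N; last by rewrite size_iota.
  apply: uniq_leq_size; first exact: iota_uniq.
  move=> x; rewrite mem_iota0 ltnS => xy.
  have yv : y \in L ++ m :: R by rewrite mem_cat inE yR !orbT.
  have : x \in L ++ m :: R by apply: below_full => //; apply: leq_ltn_trans (bv _ yv).
  rewrite mem_cat inE => /or3P[xL|/eqP xm|//].
    by have := LgtR _ _ xL yR; rewrite ltnNge xy.
  have := bv _ yv; rewrite size_cat /= addnS ltnS -sLR -xm => yx.
  have /eqP E : x == y by rewrite eqn_leq xy yx.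
  by rewrite E yR.
have LgeR x : x \in L -> (size R <= x)%N.
  move=> xL; rewrite leqNgt; apply/negP => /(below_full uR bR) xR.
  by have := LgtR _ _ xL xR; rewrite ltnn.
pose L' := map (subn^~ (size R)) L.
have EL : L = map (addn (size R)) L'.
  rewrite -map_comp -[LHS]map_id; apply/eq_in_map => x /LgeR h /=; by rewrite subnKC.
have sL' : size L' = size L by rewrite size_map.
have uL' : uniq L' by rewrite -(map_inj_uniq (@addnI (size R))) -EL.
have bL' : below L'.
  move=> x xL'; have xL : (size R + x)%N \in L by rewrite EL mem_map //; apply: addnI.
  have := bv (size R + x)%N ltac:(by rewrite mem_cat xL).
  rewrite size_cat /= addnS ltnS -sLR leq_eqVlt sL' => /orP[/eqP E|]; last by rewrite sLR addnC ltn_add2r.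
  by rewrite -E xL in mL.
have Ev : L ++ m :: R = skew (dsum1 L') R.
  by rewrite /skew /dsum1 map_rcons cat_rcons -EL sL' sLR addnC.
move: v132; rewrite Ev wocc_skew // wocc132_rcons_max // => /eqP.
rewrite addn_eq0 => /andP[/eqP L132 /eqP R132].
have [|l El] := IH L' _ uL' bL' L132.
  by rewrite sL'; move: sz; rewrite size_cat /= addnS !ltnS; apply/leq_trans/leq_addr.
have [|r Er] := IH R _ uR bR R132.
  by move: sz; rewrite size_cat /= addnS !ltnS; apply/leq_trans/leq_addl.
by exists (Node l r); rewrite El Er.
Qed.

(** * Translation between permutations and words *)

Section PermutationWords.

Variable n : nat.
Implicit Types s : 'S_n.

Definition pword s : seq nat := [seq val (s i) | i <- enum 'I_n].

Lemma size_pword s : size (pword s) = n.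
Proof. by rewrite size_map size_enum_ord. Qed.

Lemma below_pword s : below (pword s).
Proof. by move=> x /mapP[i _ ->]; rewrite size_pword /=. Qed.

Lemma uniq_pword s : uniq (pword s).
Proof. by rewrite map_inj_uniq ?enum_uniq // => i j /val_inj/perm_inj. Qed.

Lemma pword_inj : injective pword.
Proof.
move=> s t /eq_in_map E; apply/permP => i; apply: val_inj.
by apply: E; rewrite mem_enum.
Qed.

Lemma pword_surj w : uniq w -> below w -> size w = n -> exists s, pword s = w.
Proof.
move=> uw bw sw.
have wP (i : 'I_n) : (nth 0 w i < n)%N.
  by rewrite -[X in (_ < X)%N]sw; apply/bw/mem_nth; rewrite sw.
pose f i := Ordinal (wP i).
have f_inj : injective f.
  move=> i j /(congr1 val)/eqP /=; rewrite nth_uniq ?sw // => /eqP; exact: val_inj.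
exists (perm f_inj); apply: (@eq_from_nth _ 0); first by rewrite size_pword.
move=> i; rewrite size_pword => ilt.
by rewrite (nth_map (Ordinal ilt)) ?size_enum_ord // permE /= nth_enum_ord.
Qed.

Lemma pwordV s : pword (s^-1)%g = winv (pword s).
Proof.
rewrite /winv size_pword -val_enum_ord -map_comp; apply: eq_map => i /=.
have s_inj : injective (fun j => val (s j)) by move=> a b /val_inj/perm_inj.
have := index_map s_inj (enum 'I_n) ((s^-1)%g i).
by rewrite permKV index_enum_ord.
Qed.

(** Subsequences of the enumeration of positions are exactly the increasing index sequences, the
    encoding that [occ] uses. *)
Lemma mem_subs_enum m (t : seq 'I_n) :
  (t \in subs m (enum 'I_n)) = sorted ltn (map val t) && (size t == m).
Proof.
rewrite mem_subs; congr (_ && _); apply/idP/idP => [tE|st].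
  have := map_subseq val tE; rewrite val_enum_ord => /subseq_sorted; apply.
    exact: ltn_trans.
  exact: iota_ltn_sorted.
(* An increasing list is recovered from its set of members by filtering the enumeration. *)
suff -> : t = filter (mem t) (enum 'I_n) by apply: filter_subseq.
apply: (inj_map val_inj); apply: (irr_sorted_eq ltn_trans ltnn) => //.
  apply: (subseq_sorted ltn_trans (map_subseq val (filter_subseq _ _))).
  by rewrite val_enum_ord iota_ltn_sorted.
by move=> x; apply/mapP/mapP => -[i it ->]; exists i => //; move: it; rewrite mem_filter mem_enum andbT.
Qed.

(** The map [c], sending an index function to its list of values, is a bijection between the two
    counted collections. *)
Lemma occ_pword tau s : occ tau s = wocc tau (pword s).
Proof.
rewrite /occ /wocc subs_map count_map -size_filter cardE.
pose c (f : {ffun 'I_(size tau) -> 'I_n}) := map f (enum 'I_(size tau)).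
rewrite -(size_map c); apply/perm_size/uniq_perm.
- rewrite map_inj_uniq ?enum_uniq // => f g /eq_in_map E; apply/ffunP => i.
  by apply: E; rewrite mem_enum.
- by rewrite filter_uniq // subs_uniq // enum_uniq.
have sc f : size (c f) = size tau by rewrite size_map size_enum_ord.
have nthc f (a : 'I_(size tau)) x0 : nth x0 (c f) a = f a.
  by rewrite (nth_map a) ?size_enum_ord // nth_ord_enum.
have oisoE f : oiso tau (map (val \o s) (c f)) =
    [forall a : 'I_(size tau), forall b : 'I_(size tau),
       (nth 0%N tau a < nth 0%N tau b)%N == (s (f a) < s (f b))%N].
  have nthE (a : 'I_(size tau)) : nth 0 (map (val \o s) (c f)) a = s (f a).
    by rewrite (nth_map (f a)) ?sc // nthc.
  apply/oisoP/forallP => [[_ A] a|A].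
    by apply/forallP => b; rewrite -!nthE A.
  rewrite size_map sc; split=> // a b ha hb.
  by rewrite (nthE (Ordinal ha)) (nthE (Ordinal hb)); have /forallP/(_ (Ordinal hb))/eqP := A (Ordinal ha).
have sortE f : sorted ltn (map val (c f)) =
    [forall a : 'I_(size tau), forall b : 'I_(size tau), (a < b)%N ==> (f a < f b)%N].
  have nthE (a : 'I_(size tau)) : nth 0 (map val (c f)) a = f a.
    by rewrite (nth_map (f a)) ?sc // nthc.
  apply/idP/forallP => [A a|A].
    apply/forallP => b; apply/implyP => ab; rewrite -!nthE.
    by apply: (sorted_ltn_nth ltn_trans 0 A) => //; rewrite inE size_map sc.
  rewrite sorted_pairwise; last exact: ltn_trans.
  apply/(pairwiseP 0) => a b; rewrite !inE size_map sc => ha hb ab.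
  rewrite (nthE (Ordinal ha)) (nthE (Ordinal hb)).
  by have /forallP/(_ (Ordinal hb))/implyP/(_ ab) := A (Ordinal ha).
have cP f : (c f \in [seq t <- subs (size tau) (enum 'I_n) | preim (map (val \o s)) (oiso tau) t]) = is_occ s f.
  by rewrite mem_filter mem_subs_enum sc eqxx andbT /= oisoE sortE andbC.
move=> t; apply/mapP/idP => [[f fS ->]|].
  by rewrite cP; move: fS; rewrite mem_enum inE.
move=> tS; have st : size t == size tau.
  by move: tS; rewrite mem_filter mem_subs_enum => /and3P[].
have Et : t = c [ffun a => tnth (Tuple st) a].
  rewrite -[LHS](map_tnth_enum (Tuple st)).
  by apply: eq_map => a; rewrite ffunE.
by exists [ffun a => tnth (Tuple st) a] => //; rewrite mem_enum inE -cP -Et.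
Qed.

Lemma inversions_pword s : inversions s = invw (pword s).
Proof.
rewrite -wocc21 /inversions /wocc subs_map count_map -size_filter cardE.
pose c (p : 'I_n * 'I_n) := [:: p.1; p.2].
rewrite -(size_map c); apply/perm_size/uniq_perm.
- by rewrite map_inj_uniq ?enum_uniq // => -[a b] [a' b'] [-> ->].
- by rewrite filter_uniq // subs_uniq // enum_uniq.
move=> t; apply/mapP/idP => [[[a b] pS ->]|].
  move: pS; rewrite mem_enum inE mem_filter mem_subs_enum /= => /andP[ab sab].
  by rewrite ab oiso21 sab.
rewrite mem_filter mem_subs_enum; case: t => [|a [|b []]]; rewrite ?andbF //=.
rewrite oiso21 !andbT => /andP[sab ab]; exists (a, b) => //.
by rewrite mem_enum inE sab ab.
Qed.

Lemma avoids_pword s : avoids p132 s = (wocc p132 (pword s) == 0).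
Proof. by rewrite /avoids occ_pword. Qed.

Lemma involution_pword s t : pword s = word t -> involution s = (mir t == t).
Proof.
move=> E; rewrite /involution -(inj_eq pword_inj) -(inj_eq word_inj) word_mir pwordV E.
by rewrite eq_sym.
Qed.

End PermutationWords.

(** * Mirroring and occurrence counts on trees *)

Lemma appA s t u : app (app s t) u = app s (app t u).
Proof. by elim: s => //= l _ r ->. Qed.

Lemma app_Leaf t : app t Leaf = t.
Proof. by elim: t => //= l _ r ->. Qed.

Lemma mir_app s t : mir (app s t) = app (mir t) (mir s).
Proof.
elim: s => [|l _ r IH] /=; first by rewrite app_Leaf.
by rewrite IH appA.
Qed.

Lemma mirK : involutive mir.
Proof. by elim=> //= l IHl r IHr; rewrite mir_app /= IHl IHr. Qed.

Lemma tsize_app s t : tsize (app s t) = (tsize s + tsize t)%N.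
Proof. by elim: s => //= l _ r ->; rewrite addSn addnA. Qed.

Lemma tsize_mir t : tsize (mir t) = tsize t.
Proof. by elim: t => //= l IHl r IHr; rewrite tsize_app /= IHl IHr addn0 addnS addnC. Qed.

Lemma tocc0_app s t : tocc 0 (app s t) = (tocc 0 s + tocc 0 t + tsize s * tsize t)%N.
Proof.
elim: s => [|l _ r IH] /=; first by rewrite addn0.
by rewrite IH tsize_app; lia.
Qed.

Lemma toccS_app m s t : tocc m.+1 (app s t) = (tocc m.+1 s + tocc m.+1 t)%N.
Proof. by elim: s => //= l _ r ->; rewrite addnA. Qed.

(** This reflects that 213...k is its own inverse: inverting a permutation keeps the number of its
    occurrences. *)
Lemma tocc_mir m t : tocc m (mir t) = tocc m t.
Proof.
elim: t m => [|l IHl r IHr] [|m] //=.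
  by rewrite tocc0_app /= IHl IHr !tsize_mir; lia.
by rewrite toccS_app /= !IHl IHr; lia.
Qed.

(** Deleting the largest letter of an occurrence leaves one of the shorter pattern. *)
Lemma toccS_gt0 m t : (0 < tocc m.+1 t)%N -> (0 < tocc m t)%N.
Proof.
elim: t m => //= l IHl r IHr [|m].
  by move: (IHl 0) (IHr 0) => /=; lia.
by move: (IHl m) (IHr m.+1) (IHl m.+1) => /=; lia.
Qed.

(* Deleting any one of the m.+2 > 1 letters after 21 from an occurrence leaves
   an occurrence of the shorter pattern. *)
Lemma toccS_gt1 m t : (0 < tocc m.+2 t)%N -> (1 < tocc m.+1 t)%N.
Proof.
elim: t m => //= l IHl r IHr m.
by move: (IHl m) (IHr m) (@toccS_gt0 m l) (@toccS_gt0 m.+1 l) => /=; lia.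
Qed.

(** The tree of the identity permutation, the only one without inversions. *)
Fixpoint chain n := if n is n'.+1 then Node (chain n') Leaf else Leaf.

Lemma tsize_chain n : tsize (chain n) = n.
Proof. by elim: n => //= n ->; rewrite addn0. Qed.

Lemma tocc0_chain t : (tocc 0 t == 0) = (t == chain (tsize t)).
Proof.
apply/idP/eqP => [|->]; last first.
  by elim: (tsize t) => //= n /eqP ->; rewrite muln0.
elim: t => //= l IHl [|l' r'] IHr /=; last by rewrite !addn_eq0 !muln_eq0 andbF.
by rewrite !addn0 muln0 addn0 => /IHl <-.
Qed.

(** * Enumeration of trees and of mirror-symmetric trees *)

(** [d] is fuel: the sizes [i] and [n' - i] of the subtrees are not structural predecessors. The
    list is complete once [n <= d]. *)
Fixpoint trees_upto (d n : nat) : seq tree :=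
  match d, n with
  | _, 0 => [:: Leaf]
  | 0, _.+1 => [::]
  | d'.+1, n'.+1 =>
      flatten [seq [seq Node l r | l <- trees_upto d' i, r <- trees_upto d' (n' - i)]
              | i <- iota 0 n'.+1]
  end.

Lemma trees_uptoS d n : trees_upto d.+1 n.+1 =
  flatten [seq [seq Node l r | l <- trees_upto d i, r <- trees_upto d (n - i)]
          | i <- iota 0 n.+1].
Proof. by []. Qed.

Definition trees n := trees_upto n n.

Lemma mem_trees_upto d n t : (n <= d)%N -> (t \in trees_upto d n) = (tsize t == n).
Proof.
have E0 s : (s \in [:: Leaf]) = (tsize s == 0).
  by rewrite inE; case: s => [|l r]; rewrite ?eqxx //; apply/eqP.
elim: d n t => [|d IH] [|n] t nd; rewrite ?E0 // trees_uptoS.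
case: t => [|l r].
  by apply/flatten_mapP => -[i _ /allpairsP[p []]].
apply/flatten_mapP/eqP => [[i]|[E]].
  rewrite mem_iota0 => iN /allpairsP[[l' r'] /= [+ + [-> ->]]].
  rewrite !IH; [|lia|lia] => /eqP-> /eqP->; lia.
exists (tsize l); first by rewrite mem_iota0; lia.
by apply/allpairsP; exists (l, r); rewrite !IH /=; [split=> // | |]; lia.
Qed.

Lemma mem_trees n t : (t \in trees n) = (tsize t == n).
Proof. exact: mem_trees_upto. Qed.

(** The key recovers the index of the block from any of its elements, so blocks are disjoint. *)
Lemma uniq_flatten_key (I T : eqType) (key : T -> I) (f : I -> seq T) (s : seq I) :
  uniq s -> (forall i, i \in s -> uniq (f i)) ->
  (forall i x, i \in s -> x \in f i -> key x = i) ->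
  uniq (flatten [seq f i | i <- s]).
Proof.
elim: s => //= i s IH /andP[si us] uf kf; rewrite cat_uniq uf ?mem_head //= IH //; last first.
- by move=> j x js; apply: kf; rewrite inE js orbT.
- by move=> j js; apply: uf; rewrite inE js orbT.
rewrite andbT; apply/hasPn => x /flatten_mapP[j js xj]; apply/negP => xi.
by move: si; rewrite -(kf _ _ (mem_head _ _) xi) (kf j x) ?js // inE js orbT.
Qed.

Lemma trees_upto_uniq d n : (n <= d)%N -> uniq (trees_upto d n).
Proof.
elim: d n => [|d IH] [|n] // nd; rewrite trees_uptoS.
apply: (uniq_flatten_key (key := fun t => if t is Node l _ then tsize l else 0)).
- exact: iota_uniq.
- move=> i; rewrite mem_iota0 => iN; apply: allpairs_uniq; try by apply: IH; lia.
  by move=> -[l r] [l' r'] _ _ [-> ->].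
move=> i x; rewrite mem_iota0 => iN /allpairsP[[l r] /= [+ _ ->]].
by rewrite mem_trees_upto; [move/eqP | lia].
Qed.

Lemma trees_uniq n : uniq (trees n).
Proof. exact: trees_upto_uniq. Qed.

Section TreeSums.

Variable R : pzRingType.
Local Open Scope ring_scope.

Lemma sum_treesS (G : tree -> R) n :
  \sum_(t <- trees n.+1) G t =
  \sum_(i < n.+1) \sum_(l <- trees i) \sum_(r <- trees (n - i)) G (Node l r).
Proof.
(* Unfolding [trees] leaves subtrees enumerated with excess fuel, so the lists are compared as
   duplicate-free lists with the same members. *)
have E : perm_eq (trees n.+1)
    (flatten [seq [seq Node l r | l <- trees i, r <- trees (n - i)] | i <- iota 0 n.+1]).
  apply: uniq_perm; first exact: trees_uniq.
    apply: (uniq_flatten_key (key := fun t => if t is Node l _ then tsize l else 0%N)).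
    - exact: iota_uniq.
    - move=> i _; apply: allpairs_uniq; try exact: trees_uniq.
      by move=> -[l r] [l' r'] _ _ [-> ->].
    move=> i x _ /allpairsP[[l r] /= [+ _ ->]].
    by rewrite mem_trees => /eqP.
  move=> t; rewrite mem_trees; apply/eqP/flatten_mapP => [tn|[i]].
    case: t tn => // l r [E]; exists (tsize l); first by rewrite mem_iota0; lia.
    by apply/allpairsP; exists (l, r); rewrite !mem_trees /=; split=> //; lia.
  rewrite mem_iota0 => iN /allpairsP[[l r] /= [+ + ->]].
  by rewrite !mem_trees /= => /eqP-> /eqP->; lia.
rewrite (perm_big _ E) big_flatten big_map -[X in iota _ X]subn0 -/(index_iota 0 n.+1) big_mkord.
by apply: eq_bigr => i _; rewrite big_allpairs_dep.
Qed.

Definition symtrees n := [seq t <- trees n | mir t == t].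

(** The tree of A (-) M (-) A^-1 with A = L (+) 1. *)
Definition wrap l M := Node l (app M (Node (mir l) Leaf)).

Lemma tsize_wrap l M : tsize (wrap l M) = ((tsize l).+1.*2 + tsize M)%N.
Proof. by rewrite /= tsize_app /= tsize_mir; lia. Qed.

Lemma mir_wrap l M : mir (wrap l M) = wrap l (mir M).
Proof. by rewrite /= mir_app /= mirK. Qed.

Lemma app_snoc_inj M M' a : app M (Node a Leaf) = app M' (Node a Leaf) -> M = M'.
Proof. by move/(congr1 mir); rewrite !mir_app => -[/(can_inj mirK)]. Qed.

Lemma wrap_inj l M l' M' : wrap l M = wrap l' M' -> l = l' /\ M = M'.
Proof. by move=> [-> /app_snoc_inj]. Qed.

(** Mirroring reverses the components of the right spine, so the last one mirrors the first. A
    single component is its own mirror; otherwise those strictly in between form [M]. *)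
Lemma mir_fixed l r : mir (Node l r) = Node l r ->
  (r = Leaf /\ mir l = l) \/ exists2 M, mir M = M & Node l r = wrap l M.
Proof.
move=> E; case Er: (mir r) => [|b M]; rewrite /= Er /= in E.
  by case: E => El <-; left.
case: E => _ Er2; right; exists M; last by rewrite /wrap Er2.
by move: Er; rewrite -Er2 mir_app /= => -[_ ->].
Qed.

Lemma mem_symtrees n t : (t \in symtrees n) = (mir t == t) && (tsize t == n).
Proof. by rewrite mem_filter mem_trees. Qed.

Lemma symtrees_uniq n : uniq (symtrees n).
Proof. by rewrite filter_uniq ?trees_uniq. Qed.

(** The side condition already forces [i < n], so any [N >= n] may bound the sum; this lets [N] be a
    fixed truncation order later. *)
Lemma sum_symtreesS (G : tree -> R) n N : (n <= N)%N ->
  \sum_(t <- symtrees n.+1) G t =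
  \sum_(l <- symtrees n) G (Node l Leaf) +
  \sum_(i < N | (i.+1.*2 <= n.+1)%N) \sum_(l <- trees i)
     \sum_(M <- symtrees (n.+1 - i.+1.*2)) G (wrap l M).
Proof.
move=> nN.
pose W i := [seq wrap l M | l <- trees i, M <- symtrees (n.+1 - i.+1.*2)].
have E : perm_eq (symtrees n.+1) ([seq Node l Leaf | l <- symtrees n] ++
    flatten [seq W i | i <- [seq i <- iota 0 N | i.+1.*2 <= n.+1]%N]).
  apply: uniq_perm; first exact: symtrees_uniq.
    rewrite cat_uniq map_inj_uniq ?symtrees_uniq /=; last by move=> ? ? [].
    apply/andP; split.
      apply/hasPn => t /flatten_mapP[i _ /allpairsP[[l M] /= [_ _ ->]]].
      by apply/mapP => -[l' _ [_]]; case: M.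
    apply: (uniq_flatten_key (key := fun t => if t is Node l _ then tsize l else 0%N)).
    - by rewrite filter_uniq ?iota_uniq.
    - move=> i _; apply: allpairs_uniq; rewrite ?trees_uniq ?symtrees_uniq //.
      by move=> -[l r] [l' r'] _ _ /wrap_inj[/= -> ->].
    move=> i x _ /allpairsP[[l r] /= [+ _ ->]].
    by rewrite mem_trees => /eqP.
  move=> t; rewrite mem_cat; apply/idP/orP => [|[/mapP[l]|/flatten_mapP[i]]].
  - rewrite mem_symtrees => /andP[/eqP + /eqP]; case: t => // l r.
    case/mir_fixed => [[-> ml] /= [tn]|[M MM ->]].
      by left; rewrite map_f // mem_symtrees ml eqxx -tn addn0 /=.
    rewrite tsize_wrap => tn; right; apply/flatten_mapP; exists (tsize l).
      by rewrite mem_filter mem_iota0; lia.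
    apply/allpairsP; exists (l, M); rewrite mem_trees mem_symtrees /= MM !eqxx /=; split=> //.
    by lia.
  - rewrite !mem_symtrees => /andP[/eqP ml /eqP tn] ->.
    by rewrite /= ml tn addn0 !eqxx.
  rewrite mem_filter => /andP[iN _] /allpairsP[[l M] /= [+ + ->]].
  rewrite mem_trees !mem_symtrees => /eqP ti /andP[/eqP MM /eqP tM].
  by rewrite mir_wrap MM eqxx tsize_wrap ti tM; lia.
rewrite (perm_big _ E) big_cat big_map; congr (_ + _).
rewrite big_flatten big_map big_filter -[X in iota _ X]subn0 -/(index_iota 0 N) big_mkord.
by apply: eq_bigr => i _; rewrite big_allpairs_dep.
Qed.

End TreeSums.

(** * Recurrences for avoiders and for signed symmetric trees *)

Section Counts.

Variable R : comNzRingType.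
Local Open Scope ring_scope.

(** The coefficients of R_(m+2), as [avoidersP_chebD] shows. *)
Definition avoiders (m n : nat) : R := \sum_(t <- trees n) (tocc m t == 0%N)%:R.

Lemma avoiders0 n : avoiders 0 n = 1.
Proof.
rewrite /avoiders (bigD1_seq (chain n)) ?trees_uniq ?mem_trees ?tsize_chain //=.
rewrite tocc0_chain tsize_chain eqxx big1_seq ?addr0 // => t /andP[tn].
by rewrite mem_trees tocc0_chain => /eqP ->; rewrite (negPf tn).
Qed.

Lemma avoiders_n0 m : avoiders m 0 = 1.
Proof. by rewrite /avoiders big_seq1. Qed.

Lemma toccS_eq0 m t : ((tocc m.+1 t + tocc m t)%N == 0%N) = (tocc m t == 0%N).
Proof. have := @toccS_gt0 m t; lia. Qed.

Lemma avoidersS m n :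
  avoiders m.+1 n.+1 = \sum_(i < n.+1) avoiders m i * avoiders m.+1 (n - i).
Proof.
rewrite /avoiders sum_treesS; apply: eq_bigr => i _.
rewrite mulr_suml; apply: eq_bigr => l _; rewrite mulr_sumr; apply: eq_bigr => r _.
by rewrite -natrM mulnb /= addn_eq0 toccS_eq0.
Qed.

Variable e : R.

(** For [m > 0], the coefficients of F_(m+2) of the overview; at [e] = -1 the weight is the sign of
    the permutation. *)
Definition symsum (m n : nat) : R :=
  \sum_(t <- symtrees n) (tocc m t == 1%N)%:R * e ^+ tocc 0 t.

Lemma symsum0 m : symsum m 0 = 0.
Proof. by rewrite /symsum big_filter big_mkcond big_seq1 /= mul0r if_same. Qed.

Definition tree21 := Node Leaf (Node Leaf Leaf).

(** An occurrence of 213 contains an inversion, so the sum is 1 only for one inversion and no 213. A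
    single inversion is an adjacent descent; a letter before it would create 132 and a letter after
    it 213. *)
Lemma tocc_tree21 t : ((tocc 1 t + tocc 0 t)%N == 1%N) = (t == tree21).
Proof.
apply/idP/eqP => [|->//].
case: t => //= l r /eqP h.
have := @toccS_gt0 0 l.
case: l h => [|l1 l2] /=; last by case: r => [|r1 r2] /= h h1; lia.
case: r => [|r1 r2] //= h _.
by case: r1 h => [|? ?] /=; case: r2 => [|? ?] /= h; rewrite /tree21 //; lia.
Qed.

Hypothesis e2 : e ^+ 2 = 1.

Lemma expe_odd a b : odd a = odd b -> e ^+ a = e ^+ b.
Proof.
move=> ab; rewrite -(odd_double_half a) -(odd_double_half b) ab !exprD -!mul2n.
by rewrite !exprM e2 !expr1n.
Qed.

(** Modulo 2, inversions within A cancel those within A^-1, and pairs A, M cancel pairs M, A^-1. The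
    pairs between A and A^-1 remain, a square number with the parity of |A|. *)
Lemma tocc_wrap_odd l M : odd (tocc 0 (wrap l M)) = odd ((tsize l).+1 + tocc 0 M).
Proof.
rewrite /= tocc0_app tsize_app /= tocc_mir tsize_mir !(addn0, muln0) !(oddD, oddM, oddS).
by case: (odd (tocc 0 l)); case: (odd (tocc 0 M)); case: (odd (tsize l)); case: (odd (tsize M)).
Qed.

(** Occurrences in A reappear in A^-1 and hence contribute an even number, so the single one lies in
    [M]. *)
Lemma tocc_wrap m l M :
  (tocc m.+1 (wrap l M) == 1%N) = (tocc m l == 0%N) && (tocc m.+1 M == 1%N).
Proof.
rewrite /= toccS_app /= !tocc_mir; have := toccS_eq0 m l; lia.
Qed.

Lemma symsumS m n N : (n <= N)%N ->
  symsum m.+1 n.+1 =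
  (if m is 0 then (n == 2)%:R * e else symsum m n) +
  \sum_(i < N | (i.+1.*2 <= n.+1)%N)
     e ^+ i.+1 * avoiders m i * symsum m.+1 (n.+1 - i.+1.*2).
Proof.
move=> nN; rewrite /symsum (sum_symtreesS _ nN); congr (_ + _).
  case: m => [|m].
    have -> : (n == 2)%:R * e = \sum_(l <- symtrees n) (l == tree21)%:R * e.
      have <- : (tree21 \in symtrees n) = (n == 2) by rewrite mem_symtrees eqxx eq_sym.
      have [tn|tn] := boolP (tree21 \in symtrees n).
        rewrite (bigD1_seq tree21) ?symtrees_uniq //= eqxx big1 ?addr0 // => t /negPf->.
        by rewrite mul0r.
      rewrite mul0r big1_seq // => t /andP[_ tS].
      by case: eqP tS tn => [->|_ _ _]; [move=> -> | rewrite mul0r].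
    apply: eq_bigr => l _ /=; rewrite addn0 tocc_tree21.
    by case: eqP => [->|_]; rewrite ?mul0r //= expr1.
  apply: eq_bigr => l _ /=; rewrite !addn0 muln0 addn0; congr (_%:R * _).
  (* An occurrence of the longer pattern in [l] would bring two of the shorter one, so the total is
     1 exactly when the shorter pattern occurs once. *)
  have := @toccS_gt1 m l; lia.
apply: eq_bigr => i _; rewrite mulrAC /avoiders mulr_sumr.
rewrite big_seq [RHS]big_seq; apply: eq_bigr => l; rewrite mem_trees => /eqP li.
rewrite mulrAC mulr_sumr; apply: eq_bigr => M _.
rewrite (expe_odd (tocc_wrap_odd l M)) tocc_wrap li exprD -mulnb natrM; ring.
Qed.

End Counts.

(** * Chebyshev quotients and generating functions *)

Section ChebyshevDenominators.

Local Open Scope ring_scope.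

(* [chebD (x ^+ 2) k = x ^+ k * chebU k (1 / (2 * x))], so that
   R_k(y) = chebD y k.-1 / chebD y k. *)
Fixpoint chebD (A : pzRingType) (y : A) (k : nat) : A :=
  match k with
  | 0 => 1
  | k1.+1 => if k1 is k2.+1 then chebD y k1 - y * chebD y k2 else 1
  end.

Lemma chebDSS (A : pzRingType) (y : A) k :
  chebD y k.+2 = chebD y k.+1 - y * chebD y k.
Proof. by []. Qed.

Lemma rmorph_chebD (A B : pzRingType) (f : {rmorphism A -> B}) y k :
  f (chebD y k) = chebD (f y) k.
Proof.
suff : f (chebD y k) = chebD (f y) k /\ f (chebD y k.+1) = chebD (f y) k.+1 by case.
elim: k => [|k [IH1 IH2]]; first by rewrite /= rmorph1.
by split=> //; rewrite !chebDSS rmorphB rmorphM IH1 IH2.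
Qed.

Lemma chebD0 (A : pzRingType) k : chebD (0 : A) k = 1.
Proof.
suff : chebD (0 : A) k = 1 /\ chebD (0 : A) k.+1 = 1 by case.
by elim: k => [|k [IH1 IH2]] //; rewrite chebDSS IH2 mul0r subr0.
Qed.

Variables (K : fieldType) (two_neq0 : 2%:R != 0 :> K).
Implicit Types x : K.

Lemma chebU_chebD x k : x != 0 ->
  chebU k (1 / (2%:R * x)) = chebD (x ^+ 2) k / x ^+ k.
Proof.
move=> x0.
suff : chebU k (1 / (2%:R * x)) = chebD (x ^+ 2) k / x ^+ k /\
    chebU k.+1 (1 / (2%:R * x)) = chebD (x ^+ 2) k.+1 / x ^+ k.+1 by case.
elim: k => [|k [IH1 IH2]].
  by rewrite /= expr0 divr1 expr1 !div1r invfM mulrA divff // mul1r.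
split=> //.
have -> : chebU k.+2 (1 / (2%:R * x)) =
  2%:R * (1 / (2%:R * x)) * chebU k.+1 (1 / (2%:R * x)) - chebU k (1 / (2%:R * x)) by [].
rewrite IH1 IH2 chebDSS !exprS; field.
by rewrite two_neq0 x0 expf_neq0.
Qed.

Lemma chebR_chebD x k : x != 0 -> chebD (x ^+ 2) k.+1 != 0 ->
  chebR k.+1 (x ^+ 2) = chebD (x ^+ 2) k / chebD (x ^+ 2) k.+1.
Proof.
move=> x0 D0; rewrite chebR_sqr // !chebU_chebD // -pred_Sn (exprS x k); field.
by rewrite x0 D0 expf_neq0.
Qed.

(* Telescoping in j: R_j(y) - R_j(-y) = 2 y R_j(y) R_j(-y) R^e_(j-1)(y). *)
Lemma telescoped_sum (x i : K) m :
  x != 0 -> i ^+ 2 = - 1 ->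
  (forall k, chebD (x ^+ 2) k != 0) -> (forall k, chebD (- x ^+ 2) k != 0) ->
  (1 - x ^+ 2) *
     \sum_(3 <= j < m.+3)
        (x ^+ (m.+2 + 2 - j) * chebRe j.-1 (x ^+ 2) *
           \prod_(j <= i < m.+3) chebR i (- x ^+ 2))
          / chebU j (1 / (2%:R * x)) =
  2%:R^-1 * x ^+ m.+2 * ((1 - x ^+ 2) / chebD (x ^+ 2) m.+2 -
                         (1 + x ^+ 2) / chebD (- x ^+ 2) m.+2).
Proof.
move=> x0 i2 D1 D2.
(* The root [i] of -1 makes [- x ^+ 2] a square, so that [chebR] can be evaluated there. *)
have x2E : - x ^+ 2 = (i * x) ^+ 2 by rewrite exprMn i2 mulN1r.
have ix0 : i * x != 0.
  rewrite mulf_neq0 //; apply: contra_eq_neq i2 => ->.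
  by rewrite expr0n eq_sym oppr_eq0 oner_eq0.
have R1 k : chebR k.+1 (x ^+ 2) = chebD (x ^+ 2) k / chebD (x ^+ 2) k.+1.
  exact: chebR_chebD.
have R2 k : chebR k.+1 (- x ^+ 2) = chebD (- x ^+ 2) k / chebD (- x ^+ 2) k.+1.
  by rewrite x2E chebR_chebD // -x2E.
elim: m => [|m IH].
  (* The sum is empty, and both quotients are 1 because D_2(y) = 1 - y. *)
  rewrite big_geq // mulr0 /= !mulr1 opprK.
  have := D1 2; have := D2 2; rewrite /= !mulr1 opprK => h1 h2.
  by rewrite !divff // subrr mulr0.
rewrite big_nat_recr // mulrDr -pred_Sn.
(* Raising [m] multiplies every old term by the same factor, one more [x] and one more [chebR]. *)
have -> : \sum_(3 <= j < m.+3)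
        (x ^+ (m.+3 + 2 - j) * chebRe j.-1 (x ^+ 2) *
           \prod_(j <= i < m.+4) chebR i (- x ^+ 2))
          / chebU j (1 / (2%:R * x)) =
   x * chebR m.+3 (- x ^+ 2) * \sum_(3 <= j < m.+3)
        (x ^+ (m.+2 + 2 - j) * chebRe j.-1 (x ^+ 2) *
           \prod_(j <= i < m.+3) chebR i (- x ^+ 2))
          / chebU j (1 / (2%:R * x)).
  rewrite mulr_sumr; apply: eq_big_nat => j /andP[j3 jm].
  rewrite big_nat_recr; last exact: ltnW.
  rewrite (_ : (m.+3 + 2 - j = (m.+2 + 2 - j).+1)%N); last by lia.
  by rewrite (exprS x (m.+2 + 2 - j)) /=; ring.
rewrite mulrCA IH big_nat1 /chebRe !R1 !R2 chebU_chebD //.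
rewrite (_ : (m.+3 + 2 - m.+3 = 2)%N); last by lia.
have := D1 m.+3; have := D2 m.+3; have := D1 m.+2; have := D2 m.+2; have := D1 m.+1; have := D2 m.+1.
rewrite !(chebDSS _ m.+1).
move: (chebD _ m.+1) (chebD _ m.+2) (chebD _ m.+1) (chebD _ m.+2) => a b c d h1 h2 h3 h4 h5 h6.
rewrite (exprS x m.+2); field.
by rewrite h3 h4 h5 h6 two_neq0 x0 expf_neq0.
Qed.

End ChebyshevDenominators.

(** * Functional equations modulo a power of the variable *)

Section GeneratingFunctions.

Local Open Scope ring_scope.

Variables (R : comNzRingType) (N : nat).
Implicit Types p q r : {poly R}.

(** Congruence modulo ['X^N]: power series are handled through their truncations. *)
Definition eqX p q := exists r, p - q = r * 'X^N.

Lemma eqX_coef p q : (forall i, (i < N)%N -> p`_i = q`_i) -> eqX p q.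
Proof.
move=> E; exists (drop_poly N (p - q)); rewrite -[LHS](poly_take_drop N).
rewrite (_ : take_poly N (p - q) = 0) ?add0r //; apply/polyP => i.
by rewrite coef_take_poly coef0; case: ltnP => // /E; rewrite coefB => ->; rewrite subrr.
Qed.

Lemma coef_eqX p q i : eqX p q -> (i < N)%N -> p`_i = q`_i.
Proof.
move=> [r E] iN; apply/eqP; rewrite -subr_eq0 -coefB E coefMXn.
by rewrite iN.
Qed.

Definition avoidersP m : {poly R} := \poly_(i < N) avoiders R m i.

(** The truncated form of R_k = 1 / (1 - x R_(k-1)). *)
Lemma avoidersP_rec m : eqX (avoidersP m.+1) (1 + 'X * (avoidersP m * avoidersP m.+1)).
Proof.
apply: eqX_coef => -[|n] nN.
  by rewrite coef_poly nN coefD coef1 coefXM addr0 avoiders_n0.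
rewrite coef_poly nN coefD coef1 coefXM add0r avoidersS coefM /=.
apply: eq_bigr => -[i /= iN] _; rewrite !coef_poly.
by rewrite !ifT //; lia.
Qed.

Lemma avoidersP_chebD m : eqX (chebD 'X m.+2 * avoidersP m) (chebD 'X m.+1).
Proof.
elim: m => [|m [r2 E2]].
  apply: eqX_coef => -[|n] nN.
    by rewrite /= mulr1 mulrBl mul1r coefB coefXM subr0 coef_poly nN avoiders0 coef1.
  rewrite /= mulr1 mulrBl mul1r coefB coefXM !coef_poly nN (ltnW nN) !avoiders0 coef1.
  by rewrite subrr.
have [r1 E1] := avoidersP_rec m.
(* The cofactor comes from [chebD 'X m.+2] times the recurrence plus ['X * avoidersP m.+1] times the
   induction hypothesis. *)
exists (chebD 'X m.+2 * r1 + 'X * r2 * avoidersP m.+1).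
transitivity (chebD 'X m.+2 * (r1 * 'X^N) + 'X * avoidersP m.+1 * (r2 * 'X^N)); last by ring.
by rewrite -E1 -E2 (chebDSS _ m.+1); ring.
Qed.

Variable e : R.
Hypothesis e2 : e ^+ 2 = 1.

Let y : {poly R} := e%:P * 'X^2.

Lemma eqX_comp p q : eqX p q -> eqX (p \Po y) (q \Po y).
Proof.
move=> [r E]; exists ((r \Po y) * e%:P ^+ N * 'X^N).
rewrite -comp_polyB E comp_polyM comp_Xn_poly exprMn -exprM mul2n -addnn exprD.
by ring.
Qed.

Definition symsumP m : {poly R} := \poly_(i < N) symsum e m i.

Lemma symsumP_rec m : eqX (symsumP m.+1)
  ((if m is 0 then e%:P * 'X^3 else 'X * symsumP m) +
   y * (avoidersP m \Po y) * symsumP m.+1).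
Proof.
(* Substituting [y] puts the sign [e ^+ i.+1] and the degree [i.+1.*2] of the pair A, A^-1 on each
   avoider of size [i]. *)
have yE : y * (avoidersP m \Po y) * symsumP m.+1 =
    \sum_(i < N) (e ^+ i.+1 * avoiders R m i)%:P * ('X^(i.+1.*2) * symsumP m.+1).
  rewrite /avoidersP poly_def raddf_sum mulr_sumr mulr_suml; apply: eq_bigr => i _.
  rewrite /= comp_polyZ comp_Xn_poly -mul_polyC polyCM polyC_exp.
  transitivity ((avoiders R m i)%:P * y ^+ i.+1 * symsumP m.+1); first by rewrite exprS; ring.
  by rewrite exprMn -exprM mul2n; ring.
apply: eqX_coef => -[|n] nN.
  rewrite coefD yE coef_sum coef_poly nN symsum0 big1 ?addr0; last first.
    by move=> i _; rewrite coefCM coefXnM mulr0.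
  by case: m {yE} => [|m]; rewrite ?coefCM ?coefXn ?mulr0 ?coefXM.
rewrite coefD yE coef_sum coef_poly nN (symsumS e2 m (ltnW (ltnW nN))); congr (_ + _).
  case: m {yE} => [|m]; first by rewrite coefCM coefXn mulrC.
  by rewrite coefXM coef_poly /= ltnW.
rewrite big_mkcond; apply: eq_bigr => i _; rewrite coefCM coefXnM.
case: leqP => h; last by rewrite mulr0.
by rewrite coef_poly ifT //; lia.
Qed.

(** The product R_3(y) ... R_k(y) telescopes to D_2(y) / D_k(y), and D_2(y) = 1 - y. *)
Lemma symsumP_chebD m :
  eqX (symsumP m.+1 * chebD y m.+3) (e%:P * 'X^(m.+3) * (1 - y)).
Proof.
pose base k : {poly R} := if k is 0 then e%:P * 'X^3 else 'X * symsumP k.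
(* Multiplying the functional equation by D_(k+2) turns its factor 1 - y R_(k+2)(y) into D_(k+2) - y
   D_(k+1) = D_(k+3). *)
have step k : eqX (symsumP k.+1 * chebD y k.+3) (base k * chebD y k.+2).
  have [r1 E1] : eqX (symsumP k.+1) (base k + y * (avoidersP k \Po y) * symsumP k.+1).
    exact: symsumP_rec.
  have [r2 E2] : eqX (chebD y k.+2 * (avoidersP k \Po y)) (chebD y k.+1).
    have := eqX_comp (avoidersP_chebD k).
    by rewrite comp_polyM !(rmorph_chebD (comp_poly y)) /= comp_polyX.
  exists (r1 * chebD y k.+2 + y * symsumP k.+1 * r2).
  transitivity (chebD y k.+2 * (r1 * 'X^N) + y * symsumP k.+1 * (r2 * 'X^N)); last by ring.
  by rewrite -E1 -E2 (chebDSS _ k.+1); ring.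
elim: m => [|m [r IH]].
  by have [r E] := step 0; exists r; rewrite -E /= mulr1.
have [r' E] := step m.+1; exists (r' + 'X * r).
transitivity (r' * 'X^N + 'X * (r * 'X^N)); last by ring.
by rewrite -E -IH (exprS _ m.+3) /base; ring.
Qed.

End GeneratingFunctions.

(** * From permutations to the final generating function *)

Lemma even_inv_count_trees m n :
  even_inv_count (pattern2134 m.+2) 1 n =
  count (fun t => ~~ odd (tocc 0 t) && (tocc m t == 1)) (symtrees n).
Proof.
(* Permutations and trees are both mapped injectively to words, and the two resulting lists have the
   same members. *)
rewrite -size_filter /even_inv_count cardE -(size_map (@pword n)) -(size_map word (filter _ _)).
apply/perm_size/uniq_perm.
- by rewrite map_inj_uniq ?enum_uniq //; apply: pword_inj.
- by rewrite (map_inj_uniq word_inj) filter_uniq // symtrees_uniq.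
have P (s : 'S_n) t : pword s = word t -> [&& involution s, even_inversions s,
    avoids p132 s & occ (pattern2134 m.+2) s == 1] =
    (t \in [seq t <- symtrees n | ~~ odd (tocc 0 t) && (tocc m t == 1)]).
  move=> E; rewrite mem_filter mem_symtrees (involution_pword E) /even_inversions.
  rewrite inversions_pword avoids_pword occ_pword E invw_word wocc132_word wocc_word.
  rewrite -size_word -E size_pword !eqxx andbT /=.
  by rewrite andbC.
move=> w; apply/mapP/mapP => [[s]|[t]].
  rewrite mem_enum inE => sS ->.
  have [|t E] := word_surj (uniq_pword s) (@below_pword n s).
    by apply/eqP; rewrite -avoids_pword; case/and4P: sS.
  by exists t => //; rewrite -(P _ _ E).
move=> tS ->; have tn : tsize t = n.
  by move: tS; rewrite mem_filter mem_symtrees => /and3P[_ _ /eqP].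
have [|s E] := pword_surj (uniq_word t) (@below_word t) (n := n).
  by rewrite size_word.
by exists s => //; rewrite mem_enum inE (P _ _ E).
Qed.

(** The weights at [e] = 1 and [e] = -1 add to 2 on even permutations and cancel on odd ones. *)
Lemma even_inv_count_symsum (R : comNzRingType) m n :
  ((even_inv_count (pattern2134 m.+2) 1 n)%:R *+ 2 = symsum 1 m n + symsum (-1) m n :> R)%R.
Proof.
rewrite even_inv_count_trees -sum1_count natr_sum -sumrMnl big_mkcond /symsum -big_split.
apply: eq_bigr => t _ /=; rewrite expr1n -signr_odd andbC.
by case: (tocc m t == 1); case: (odd _); rewrite /= ?mul0r ?mul1r ?addr0 ?expr1 ?subrr ?expr0.
Qed.

Local Open Scope ring_scope.

(** Ensures that the denominators are nonzero and invertible as power series. *)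
Lemma coef0_chebD (R : comNzRingType) (y : {poly R}) k :
  y`_0 = 0 -> (chebD y k)`_0 = 1.
Proof.
move=> y0; rewrite -horner_coef0 -[LHS]/(horner_eval 0 (chebD y k)).
by rewrite rmorph_chebD /= /horner_eval horner_coef0 y0 chebD0.
Qed.

Lemma tofrac_chebD_neq0 (R : idomainType) (y : {poly R}) k :
  y`_0 = 0 -> chebD (y%:F) k != 0.
Proof.
move=> y0; rewrite -(rmorph_chebD (@FracField.tofrac _)) tofrac_eq0.
by apply: contra_eq_neq (coef0_chebD k y0) => ->; rewrite coef0 eq_sym oner_neq0.
Qed.

(** Puts the telescoped sum over the common denominator, as the quotient of two images under [f]
    that [is_gen_fun] asks for. *)
Lemma telescoped_sum_rmorph (A : comNzRingType) (K : fieldType) (f : {rmorphism A -> K})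
    (X h y1 y2 : A) (i : K) m :
  2%:R != 0 :> K -> f X != 0 -> i ^+ 2 = - 1 ->
  f h = 2%:R^-1 -> f y1 = f X ^+ 2 -> f y2 = - f X ^+ 2 ->
  (forall k, chebD (f y1) k != 0) -> (forall k, chebD (f y2) k != 0) ->
  (1 - f X ^+ 2) *
     \sum_(3 <= j < m.+3)
        (f X ^+ (m.+2 + 2 - j) * chebRe j.-1 (f X ^+ 2) *
           \prod_(j <= i < m.+3) chebR i (- f X ^+ 2))
          / chebU j (1 / (2%:R * f X)) =
  f (h * X ^+ m.+2 * ((1 - y1) * chebD y2 m.+2 - (1 - y2) * chebD y1 m.+2)) /
  f (chebD y1 m.+2 * chebD y2 m.+2).
Proof.
move=> two_neq0 x0 i2 fh fy1 fy2; rewrite fy1 fy2 => D1 D2.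
rewrite (telescoped_sum two_neq0 m x0 i2 D1 D2).
rewrite (rmorphM f (h * _)) (rmorphM f h) fh rmorphXn rmorphB !rmorphM !rmorph_chebD.
rewrite !rmorphB rmorph1 fy1 fy2.
move: (D1 m.+2) (D2 m.+2); move: (chebD _ _) (chebD _ _) => a b a0 b0.
by field; rewrite a0 b0.
Qed.

(** Half the sum of [symsumP_chebD] at [e] = 1 and [e] = -1, over the product of both denominators;
    the minus sign is the factor [e]. *)
Lemma even_inv_count_eqX (K : fieldType) m N : 2%:R != 0 :> K ->
  let y (e : K) : {poly K} := e%:P * 'X^2 in
  eqX N (chebD (y 1) m.+3 * chebD (y (-1)) m.+3 *
           \poly_(n < N) (even_inv_count (pattern2134 m.+3) 1 n)%:R)
        (2%:R^-1%:P * 'X^(m.+3) *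
           ((1 - y 1) * chebD (y (-1)) m.+3 - (1 - y (-1)) * chebD (y 1) m.+3)).
Proof.
move=> two_neq0 y.
have [r1 E1] := symsumP_chebD N (expr1n K 2) m.
have [r2 E2] := symsumP_chebD N (etrans (sqrrN 1) (expr1n K 2)) m.
rewrite -/(y 1) -/(y (-1)) in E1 E2.
have -> : \poly_(n < N) (even_inv_count (pattern2134 m.+3) 1 n)%:R =
    2%:R^-1%:P * (symsumP N 1 m.+1 + symsumP N (-1) m.+1) :> {poly K}.
  apply/polyP => n; rewrite coefCM coefD !coef_poly; case: ifP => _; last by rewrite addr0 mulr0.
  by rewrite -even_inv_count_symsum -[X in _ * X]mulr_natl mulKf.
exists (2%:R^-1%:P * (chebD (y (-1)) m.+3 * r1 + chebD (y 1) m.+3 * r2)).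
transitivity (2%:R^-1%:P * (chebD (y (-1)) m.+3 * (r1 * 'X^N) + chebD (y 1) m.+3 * (r2 * 'X^N))); last by ring.
rewrite -E1 -E2 polyCN polyC1.
move: (y 1) (y (-1)) (2%:R^-1%:P) => y1 y2 h.
move: (chebD y1 _) (chebD y2 _) (symsumP _ _ _) (symsumP _ _ _) ('X^(m.+3)) => a b c d X.
by ring.
Qed.

Lemma even_inv_gen_fun (C : fieldType) (i : C) k :
  i ^+ 2 = -1 -> 2%:R != 0 :> C -> (2 <= k)%N ->
  let x : {fraction {poly C}} := 'X%:F in
  is_gen_fun (fun n => (even_inv_count (pattern2134 k) 1 n)%:R)
    ((1 - x ^+ 2) *
     \sum_(3 <= j < k.+1)
        (x ^+ (k + 2 - j) * chebRe j.-1 (x ^+ 2) *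
           \prod_(j <= i < k.+1) chebR i (- x ^+ 2))
          / chebU j (1 / (2%:R * x))).
Proof.
move=> iC two_neq0 k2 x; case: k k2 => [|[|[|m]]] // _.
  (* For k = 2 the sum is empty, and one occurrence of 21 means one inversion, which is never
     even. *)
  exists 0, 1; split=> [||n]; first by rewrite coef1 oner_neq0.
    by rewrite big_geq // mulr0 tofrac0 mul0r.
  rewrite coef0 big1 // => j _; rewrite even_inv_count_trees.
  rewrite (@eq_count _ _ pred0) ?count_pred0 ?mulr0 // => t /=.
  by case: eqP => [->|]; rewrite ?andbF.
pose y (e : C) := e%:P * 'X^2.
have y0 e : (y e)`_0 = 0 by rewrite coefCM coefXn mulr0.
have y1F : (y 1)%:F = x ^+ 2 by rewrite /y mul1r -tofracXn.
have y2F : (y (-1))%:F = - x ^+ 2 by rewrite /y polyCN mulN1r tofracN -tofracXn.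
have twoF : (2%:R^-1)%:P%:F = 2%:R^-1 :> {fraction {poly C}}.
  have := fmorphV (@FracField.tofrac {poly C} \o polyC) 2%:R.
  by rewrite rmorph_nat.
exists (2%:R^-1%:P * 'X^(m.+3) *
        ((1 - y 1) * chebD (y (-1)) m.+3 - (1 - y (-1)) * chebD (y 1) m.+3)).
exists (chebD (y 1) m.+3 * chebD (y (-1)) m.+3).
have two_neq0F : 2%:R != 0 :> {fraction {poly C}}.
  by rewrite -tofrac1 -tofracMn tofrac_eq0 -polyC1 -polyCMn polyC_eq0.
have x0 : x != 0 by rewrite tofrac_eq0 polyX_eq0.
have i2F : (i%:P)%:F ^+ 2 = -1 :> {fraction {poly C}}.
  by rewrite -tofracXn -polyC_exp iC polyCN tofracN tofrac1.
split=> [||n].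
- by rewrite coef0M !coef0_chebD // mulr1 oner_neq0.
- apply: (telescoped_sum_rmorph (f := @FracField.tofrac _) _ two_neq0F x0 i2F twoF y1F y2F).
    by move=> k; apply: tofrac_chebD_neq0.
  by move=> k; apply: tofrac_chebD_neq0.
(* Truncating at order [n.+1] keeps every coefficient that enters the one of degree [n]. *)
rewrite -(coef_eqX (even_inv_count_eqX m n.+1 two_neq0) (ltnSn n)) coefM.
by apply: eq_bigr => j _; rewrite coef_poly ltnS leq_subr.
Qed.

Theorem theorem3p13 (k : nat) (hk : (2 <= k)%N) :
  let x : {fraction {poly algC}} := 'X%:F in
  is_gen_fun (fun n => (even_inv_count (pattern2134 k) 1 n)%:R)
    ((1 - x ^+ 2) *
     \sum_(3 <= j < k.+1)
        (x ^+ (k + 2 - j) * chebRe j.-1 (x ^+ 2) *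
           \prod_(j <= i < k.+1) chebR i (- x ^+ 2))
          / chebU j (1 / (2%:R * x))).
Proof.
apply: (even_inv_gen_fun (Num.Theory.sqrCi algC) _ hk).
by rewrite Num.Theory.pnatr_eq0.
Qed.
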